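(* Let $W(3,2,2)$ be a three-web of codimension two on a four-dimensional manifold $M^4$ with nowhere vanishing covector $a$, and let the frames be specialized so that $a_2=0$. (i) If the transversal $a$-distribution $\Delta$ is integrable on the web $W(3,2,2)$, then its integral surfaces $V^2$ are totally geodesic on $M^4$ in any affine connection $\Gamma$ of the bundle of affine connections defined by the forms $$\begin{pmatrix}\theta_j^i&0\\0&\theta_j^i\end{pmatrix},\qquad \theta_j^i=\omega_j^i+a^i_{jk}\bigl(p\,\omega_{(1)}^k+q\,\omega_{(2)}^k\bigr),\quad i,j=1,2,$$ where $p,q$ are parameters. (ii) If on the web $W(3,2,2)$ the condition $$\omega_2^1=0$$ holds, then the integral surfaces $V^2$ of the $a$-distribution $\Delta$ are geodesicly parallel in any affine connection of this bundle.
   Context: A web $W(3,2,2)$ on a 4-manifold $M^4$ consists of three foliations $\lambda_1,\lambda_2,\lambda_3$ of codimension 2 in general position (their tangent planes are pairwise transversal at each point). All considerations are local. Indices $i,j,k,l$ range over $\{1,2\}$; repeated indices are summed; square brackets around indices denote alternation with averaging. The foliation $\lambda_u$ is given by $\omega_{(u)}^i=0$, $i=1,2$, where the 1-forms are normalized so that $\omega_{(1)}^i+\omega_{(2)}^i+\omega_{(3)}^i=0$; the forms $\omega_{(1)}^i,\omega_{(2)}^i$ form a coframe on $M^4$. Admissible coframe changes are $\omega_{(\alpha)}^{i'}=A^{i'}_j\omega_{(\alpha)}^j$ with the same nondegenerate matrix for $\alpha=1,2$. The structure equations are $$d\omega_{(1)}^i=\omega_{(1)}^j\wedge\omega_j^i+a_j\omega_{(1)}^j\wedge\omega_{(1)}^i,\qquad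 d\omega_{(2)}^i=\omega_{(2)}^j\wedge\omega_j^i-a_j\omega_{(2)}^j\wedge\omega_{(2)}^i,$$ which determine the connection forms $\omega_j^i$ and the covector $a=\{a_1,a_2\}$; the torsion tensor is $a^i_{jk}=a_{[j}\delta^i_{k]}$. Further, $$d\omega_j^i-\omega_j^k\wedge\omega_k^i=b^i_{jkl}\,\omega_{(1)}^k\wedge\omega_{(2)}^l,\qquad da_i-a_j\omega_i^j=p_{ij}\omega_{(1)}^j+q_{ij}\omega_{(2)}^j .$$ The transversal $a$-distribution $\Delta$ is defined by $a_1\omega_{(1)}^1+a_2\omega_{(1)}^2=0$, $a_1\omega_{(2)}^1+a_2\omega_{(2)}^2=0$. One may always specialize the frames so that $a_2=0$, and then $\Delta$ is given by $\omega_{(1)}^1=\omega_{(2)}^1=0$. Let $\{e_i^\alpha\}$ ($i,\alpha=1,2$) be the vector frame dual to $\{\omega_{(\alpha)}^i\}$. In the affine connection $\Gamma$ with the forms $\theta_j^i$ one has $\nabla e_i^\alpha=\theta_i^j e_j^\alpha$ for $\alpha=1,2$. In the specialized frame $\Delta$ is spanned by $e_2^1,e_2^2$. An integral surface $V^2$ is totally geodesic if its tangent planes are parallel along $V^2$, i.e. $\nabla_XY$ is tangent to $V^2$ for all $X,Y$ tangent to $V^2$. The integral surfaces are geodesicly parallel in $\Gamma$ if the bivector field $\Delta=e_2^1\wedge e_2^2$ is parallel up to a factor on all of $M^4$, i.e. $\nabla_X Y\in\Delta$ for every section $Y$ of $\Delta$ and every vector $X$ tangent to $M^4$. *)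

(* Defs.v *)
From HB Require Import structures.
From mathcomp Require Import all_boot all_order all_algebra.
From mathcomp Require Import all_classical all_reals all_analysis.
Import Order.TTheory GRing.Theory Num.Theory.
Import numFieldNormedType.Exports.

Set Implicit Arguments.
Unset Strict Implicit.
Unset Printing Implicit Defensive.

Local Open Scope classical_set_scope.
Local Open Scope ring_scope.

(** Local geometry: M^4 is an open subset U of R^4 (a coordinate chart), and
    functions on U are total functions whose values outside U are irrelevant.
    Indices 1, 2 (resp. 1, 2, 3) are the elements 0, 1 of 'I_2 (resp. 0, 1, 2 of
    'I_3). *)

Section Calculus.
Context {R : realType}.

Fixpoint Ck_on {V W : normedModType R} (k : nat) (U : set V) (f : V -> W) : Prop :=
  match k with
  | 0 => forall x, U x -> {for x, continuous f}
  | k'.+1 => (forall x, U x -> differentiable f x) /\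
             (forall v, Ck_on k' U (fun x => 'D_v f x))
  end.

Definition smooth_on {V W : normedModType R} (U : set V) (f : V -> W) : Prop :=
  forall k, Ck_on k U f.


Definition vfield := 'rV[R]_4 -> 'rV[R]_4.
Definition form1 := 'rV[R]_4 -> 'cV[R]_4.

Definition pairing (w : 'cV[R]_4) (v : 'rV[R]_4) : R := (v *m w) 0 0.

(* No factor 1/2 here nor in [dform], so the two are compatible:
   d (f dg) = df /\ dg. *)
Definition wedge (s t : form1) (x u v : 'rV[R]_4) : R :=
  pairing (s x) u * pairing (t x) v - pairing (s x) v * pairing (t x) u.

(* The arguments u, v extend to constant vector fields, so the bracket term in
   Cartan's formula vanishes. *)
Definition dform (s : form1) (x u v : 'rV[R]_4) : R :=
  'D_u (fun y => pairing (s y) v) x - 'D_v (fun y => pairing (s y) u) x.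

Definition independent {I : finType} (s : I -> 'cV[R]_4) : Prop :=
  forall c : I -> R, \sum_i c i *: s i = 0 -> forall i, c i = 0.

End Calculus.

Arguments form1 R : clear implicits.
Arguments vfield R : clear implicits.

Section PlaneFields.
Context {R : realType}.
Notation V := 'rV[R]_4.

Definition plane_field := V -> set V.

Definition codim2_plane_field (U : set V) (L : plane_field) : Prop :=
  forall x, U x -> exists W : set V, exists s : 'I_2 -> form1 R,
    [/\ open W, W x,
        forall i, smooth_on W (s i),
        forall y, W y -> independent (fun i => s i y) &
        forall y, W y -> U y -> L y = [set v | forall i, pairing (s i y) v = 0]].

Definition tangent_plane (f : 'rV[R]_2 -> V) (s : 'rV[R]_2) : set V :=
  [set 'D_v f s | v in [set: 'rV[R]_2]].

(* A local parametrization f : D -> U of an integral surface.  As the planes of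
   L have dimension 2, the last clause makes f an immersion. *)
Definition integral_surface (U : set V) (L : plane_field)
    (D : set 'rV[R]_2) (f : 'rV[R]_2 -> V) : Prop :=
  [/\ open D, smooth_on D f,
      forall s, D s -> U (f s) &
      forall s, D s -> tangent_plane f s = L (f s)].

Definition integrable_plane_field (U : set V) (L : plane_field) : Prop :=
  forall x, U x -> exists D f s, [/\ integral_surface U L D f, D s & f s = x].

Definition codim2_foliation (U : set V) (L : plane_field) : Prop :=
  codim2_plane_field U L /\ integrable_plane_field U L.

End PlaneFields.

Arguments plane_field R : clear implicits.

Section Web.
Context {R : realType}.
Notation V := 'rV[R]_4.
Implicit Types (U : set V) (lam : 'I_3 -> plane_field R)
  (om : 'I_3 -> 'I_2 -> form1 R) (w : 'I_2 -> 'I_2 -> form1 R)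
  (a : 'I_2 -> V -> R).

(* lam u x is the tangent plane at x of the leaf of the u-th foliation. *)
Record web322 U lam : Prop := Web322 {
  web_open : open U;
  web_foliation : forall u, codim2_foliation U (lam u);
  web_transversal : forall u u' x, u != u' -> U x ->
    lam u x `&` lam u' x = [set 0]
}.

(* Frame indices P = (alpha, i), with alpha and i both ranging over {1, 2}. *)
Definition coframe om (P : 'I_2 * 'I_2) : form1 R :=
  om (widen_ord (leqnSn 2) P.1) P.2.

Record adapted_coframe U lam om : Prop := AdaptedCoframe {
  adapted_smooth : forall u i, smooth_on U (om u i);
  adapted_web : forall u x, U x ->
    lam u x = [set v | forall i, pairing (om u i x) v = 0];
  adapted_sum : forall i x, U x -> om 0 i x + om 1 i x + om 2 i x = 0;
  adapted_free : forall x, U x -> independent (fun P => coframe om P x)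
}.

(* w i j is omega_j^i (upper index first), and b i j k l is b^i_{jkl}. *)
Record structure_equations U om w a
    (b : 'I_2 -> 'I_2 -> 'I_2 -> 'I_2 -> V -> R) (p q : 'I_2 -> 'I_2 -> V -> R)
    : Prop := StructureEquations {
  connection_smooth : forall i j, smooth_on U (w i j);
  covector_smooth : forall i, smooth_on U (a i : V -> R^o);
  structure1 : forall i x u v, U x ->
    dform (om 0 i) x u v =
      \sum_j wedge (om 0 j) (w i j) x u v
      + \sum_j a j x * wedge (om 0 j) (om 0 i) x u v;
  structure2 : forall i x u v, U x ->
    dform (om 1 i) x u v =
      \sum_j wedge (om 1 j) (w i j) x u v
      - \sum_j a j x * wedge (om 1 j) (om 1 i) x u v;
  structure_curvature : forall i j x u v, U x ->
    dform (w i j) x u v - \sum_k wedge (w k j) (w i k) x u v =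
      \sum_k \sum_l b i j k l x * wedge (om 0 k) (om 1 l) x u v;
  structure_covector : forall i x v, U x ->
    'D_v (a i : V -> R^o) x - \sum_j a j x * pairing (w j i x) v =
      \sum_j (p i j x * pairing (om 0 j x) v + q i j x * pairing (om 1 j x) v)
}.

Definition torsion a (i j k : 'I_2) (x : V) : R :=
  (a j x * (i == k)%:R - a k x * (i == j)%:R) / 2.

Definition a_distribution om a : plane_field R := fun x =>
  [set v | forall alpha, \sum_i a i x * pairing (coframe om (alpha, i) x) v = 0].

Definition dual_frame U om (e : 'I_2 * 'I_2 -> vfield R) : Prop :=
  forall P Q x, U x -> pairing (coframe om P x) (e Q x) = (P == Q)%:R.

(* theta_j^i *)
Definition theta om w a (p q : R) (i j : 'I_2) : form1 R := fun x =>
  w i j x + \sum_k torsion a i j k x *: (p *: om 0 k x + q *: om 1 k x).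

(* The block-diagonal matrix with both diagonal blocks equal to th, rows and
   columns being indexed by frame indices. *)
Definition block_connection (th : 'I_2 -> 'I_2 -> form1 R)
    (Q P : 'I_2 * 'I_2) : form1 R := fun x =>
  if Q.1 == P.1 then th Q.2 P.2 x else 0.

(* Covariant derivative along a map g : E -> R^4, in the direction v at s, of a
   vector field Y along g (Y s is a tangent vector at g s), for the affine
   connection nabla e_P = sum_Q Theta_P^Q e_Q.  On a parametrized surface g it
   is nabla_X Y with X = dg(v); for g = id it is nabla_v Y on the manifold. *)
Definition covariant_derivative om (e : 'I_2 * 'I_2 -> vfield R)
    (Theta : 'I_2 * 'I_2 -> 'I_2 * 'I_2 -> form1 R)
    {E : normedModType R} (g Y : E -> V) (s v : E) : V :=
  \sum_Q ('D_v (fun t => pairing (coframe om Q (g t)) (Y t) : R^o) s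
          + \sum_P pairing (Theta Q P (g s)) ('D_v g s)
                   * pairing (coframe om P (g s)) (Y s)) *: e Q (g s).

Definition totally_geodesic om e Theta (D : set 'rV[R]_2) (f : 'rV[R]_2 -> V)
    : Prop :=
  forall Y : 'rV[R]_2 -> V, smooth_on D Y ->
    (forall s, D s -> tangent_plane f s (Y s)) ->
    forall s v, D s ->
      tangent_plane f s (covariant_derivative om e Theta f Y s v).

(* The plane field L is parallel, i.e. its bivector is parallel up to a factor. *)
Definition geodesicly_parallel U om e Theta (L : plane_field R) : Prop :=
  forall Y : vfield R, smooth_on U Y -> (forall x, U x -> L x (Y x)) ->
    forall x X, U x -> L x (covariant_derivative om e Theta idfun Y x X).

End Web.

(* Main.v *)
(* In the frame with a_2 = 0 the torsion a^1_{2k} vanishes, so theta_2^1 =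
   omega_2^1 for all p, q, and nabla preserves Delta in a direction X exactly
   when omega_2^1(X) = 0: this is (ii).  For (i), omega_(1)^1 and omega_(2)^1 pull
   back to 0 on an integral surface, hence so do their differentials, and the
   structure equations reduce to omega_(alpha)^2 /\ omega_2^1 = 0 on Delta for
   alpha = 1, 2; evaluating on e_2^1, e_2^2 gives omega_2^1 = 0 on Delta. *)
Require Import Defs.
From HB Require Import structures.
From mathcomp Require Import all_boot all_order all_algebra.
From mathcomp Require Import all_classical all_reals all_analysis.
From mathcomp Require Import ring.
Import Order.TTheory GRing.Theory Num.Theory.
Import numFieldNormedType.Exports.
Local Open Scope classical_set_scope.
Local Open Scope ring_scope.

(** * Symmetry of second directional derivatives *)

(** The two difference quotients coincide. This passes to one real variable, where the mean value
    theorem is available. *)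
Lemma is_derive_line (R : numFieldType) (V W : normedModType R) (h : V -> W)
    (x u : V) (s : R) (dh : W) :
  is_derive (x + s *: u) u h dh -> is_derive s 1 (fun t : R => h (x + t *: u)) dh.
Proof.
have E : (fun k : R => k^-1 *: ((h \o shift (x + s *: u)) (k *: u)
                                - h (x + s *: u))) =
  (fun k : R => k^-1 *: (((fun t : R => h (x + t *: u)) \o shift s) k%:A
                         - h (x + s *: u))).
  apply/funext => k /=; congr (_ *: (h _ - _)).
  by rewrite [k%:A]mulr1 scalerDl addrCA addrC -addrA.
by case=> dv <-; split; rewrite /derivable /derive -E.
Qed.

(** Two uses of the mean value theorem: along [u] for the increment [phi] of [h], then along [v] for
    [hu]. *)
Lemma second_difference (R : realType) (V : normedModType R)
    (h hu huv : V -> R) (x u v : V) (d : R) :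
  0 < d ->
  (forall s t, s \in `[0, d] -> t \in `[0, d] ->
     is_derive (x + s *: u + t *: v) u h (hu (x + s *: u + t *: v)) /\
     is_derive (x + s *: u + t *: v) v hu (huv (x + s *: u + t *: v))) ->
  exists s t, [/\ s \in `[0, d], t \in `[0, d] &
    h (x + d *: u + d *: v) - h (x + d *: u) - (h (x + d *: v) - h x)
    = huv (x + s *: u + t *: v) * d * d].
Proof.
move=> d0 H.
have d_in : d \in `[0, d] by rewrite in_itv /= lexx ltW.
have z_in : 0 \in `[0, d] by rewrite in_itv /= lexx ltW.
pose phi s := h (x + d *: v + s *: u) - h (x + s *: u).
have dphi (s : R) : s \in `[0, d] ->
    is_derive s 1 phi (hu (x + s *: u + d *: v) - hu (x + s *: u)).
  move=> sd; apply: is_deriveB; apply: is_derive_line.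
    by have [+ _] := H s d sd d_in; rewrite addrAC.
  by have [+ _] := H s 0 sd z_in; rewrite scale0r addr0.
have phic : {within `[0, d], continuous phi}.
  by apply: derivable_within_continuous => y /dphi [].
have [s sd Es] := MVT_segment (ltW d0) (fun y yd => dphi y (subset_itv_oo_cc yd)) phic.
have dpsi (t : R) : t \in `[0, d] -> is_derive t 1
    (fun t => hu (x + s *: u + t *: v)) (huv (x + s *: u + t *: v)).
  by move=> td; apply: is_derive_line; have [_] := H s t sd td.
have psic : {within `[0, d], continuous (fun t => hu (x + s *: u + t *: v))}.
  by apply: derivable_within_continuous => y /dpsi [].
have [t td Et] := MVT_segment (ltW d0) (fun y yd => dpsi y (subset_itv_oo_cc yd)) psic.
exists s, t; split=> //.
move: Es Et; rewrite /phi !scale0r !addr0 !subr0 => Es Et.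
by rewrite [x + d *: u + _]addrAC Es Et.
Qed.

(** The second difference over a small parallelogram is symmetric in [u] and [v], so a value of
    [huv] equals a value of [hvu], both taken near [x]; continuity brings the two values back to [x]
    within [e]. *)
Lemma schwarz (R : realType) (V : normedModType R)
    (h hu hv huv hvu : V -> R) (x u v : V) :
  (\forall y \near x, is_derive y u h (hu y)) ->
  (\forall y \near x, is_derive y v h (hv y)) ->
  (\forall y \near x, is_derive y v hu (huv y)) ->
  (\forall y \near x, is_derive y u hv (hvu y)) ->
  {for x, continuous huv} -> {for x, continuous hvu} ->
  huv x = hvu x.
Proof.
move=> Hu Hv Huv Hvu /cvgrPdist_lt cuv /cvgrPdist_lt cvu.
apply/eqP; rewrite -subr_eq0 -normr_le0; apply/ler_addgt0Pr => e e0.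
rewrite add0r.
have e20 : 0 < e / 2 by rewrite divr_gt0.
have [r /= r0 B] : nbhs_ball x (fun y =>
  ((is_derive y u h (hu y) /\ is_derive y v hu (huv y)) /\
   (is_derive y v h (hv y) /\ is_derive y u hv (hvu y))) /\
  (`|huv x - huv y| < e / 2 /\ `|hvu x - hvu y| < e / 2)).
  apply/nbhs_ballP; near=> y.
  split; [split; split; near: y => //|split; near: y; [exact: cuv|exact: cvu]].
(* At this scale the parallelogram with edges [d *: u], [d *: v] fits in the ball; the added 1 keeps
   the denominator positive and the bound strict. *)
pose d := r / (`|u| + `|v| + 1).
have n0 : 0 < `|u| + `|v| + 1 by rewrite ltr_wpDl// addr_ge0.
have d0 : 0 < d by rewrite divr_gt0.
have inB s t : s \in `[0, d] -> t \in `[0, d] -> ball x r (x + s *: u + t *: v).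
  rewrite !in_itv /= => /andP[s0 sd] /andP[t0 td].
  rewrite -ball_normE /ball_/= -addrA opprD addNKr normrN.
  apply: le_lt_trans (ler_normD _ _) _; rewrite !normrZ !ger0_norm//.
  apply: (@le_lt_trans _ _ (d * `|u| + d * `|v|)).
    by apply: lerD; apply: ler_wpM2r.
  by rewrite -mulrDr -[ltRHS](divfK (lt0r_neq0 n0)) ltr_pM2l// ltrDl.
have [|s [t [sd td E1]]] := @second_difference R V h hu huv x u v d d0.
  by move=> s t sd td; have [[]] := B _ (inB s t sd td).
have [|t' [s' [sd' td' E2]]] := @second_difference R V h hv hvu x v u d d0.
  by move=> s' t' sd' td'; have [[_ +] _] := B _ (inB t' s' td' sd'); rewrite addrAC.
have [_ [Bu _]] := B _ (inB s t sd td).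
have [_ [_ Bv]] := B _ (inB s' t' td' sd').
(* Both sides times [d * d] are the same second difference, with its terms regrouped. *)
have E : huv (x + s *: u + t *: v) = hvu (x + s' *: u + t' *: v).
  have dn0 : d != 0 by rewrite gt_eqF.
  apply: (mulIf dn0); apply: (mulIf dn0).
  rewrite -E1 [x + s' *: u + _]addrAC -E2 [x + d *: v + _]addrAC; ring.
have -> : huv x - hvu x = (huv x - huv (x + s *: u + t *: v))
   - (hvu x - hvu (x + s' *: u + t' *: v)) by rewrite E; ring.
rewrite (le_trans (ler_normB _ _))// [leRHS]splitr lerD// ltW//.
Unshelve. all: by end_near. Qed.

(** [schwarz] applied to each coordinate; [Ck_on] at orders 1 and 2 supplies the derivatives and
    their continuity. *)
Lemma schwarz_smooth (R : realType) (V : normedModType R) (n : nat) (D : set V)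
    (f : V -> 'rV[R]_n.+1) (x u v : V) :
  open D -> smooth_on D f -> D x ->
  'D_v (fun y => 'D_u f y) x = 'D_u (fun y => 'D_v f y) x.
Proof.
move=> oD sf Dx.
have [f_diff _] := sf 1%N.
have Df_diff z : forall y, D y -> differentiable (fun y => 'D_z f y) y.
  by have [_ /(_ z) []] := sf 2%N.
have DDf_cont z z' : {for x, continuous (fun y => 'D_z' (fun y => 'D_z f y) y)}.
  by have [_ /(_ z) [_ /(_ z')]] := sf 2%N; apply.
have coord (g : V -> 'rV[R]_n.+1) (k : 'I_n.+1) z y : differentiable g y ->
    is_derive y z (fun t => g t 0 k) ('D_z g y 0 k).
  move=> /diff_derivable - /(_ z) gd; rewrite (derive_mx gd) mxE.
  by apply: derivableP; apply: (derivable_mxP g y z).1.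
have nearD := open_nbhs_nbhs (conj oD Dx).
apply/matrixP => i k; rewrite ord1.
apply: (@schwarz R V (fun t => f t 0 k) (fun t => 'D_u f t 0 k)
   (fun t => 'D_v f t 0 k) (fun t => 'D_v (fun y => 'D_u f y) t 0 k)
   (fun t => 'D_u (fun y => 'D_v f y) t 0 k) x u v).
- by apply: filterS nearD => y Dy; apply: coord; exact: f_diff.
- by apply: filterS nearD => y Dy; apply: coord; exact: f_diff.
- by apply: filterS nearD => y Dy; apply: coord; exact: Df_diff.
- by apply: filterS nearD => y Dy; apply: coord; exact: Df_diff.
- apply: (@continuous_comp _ _ _ _ (fun M : 'rV[R]_n.+1 => M 0 k)).
    exact: (DDf_cont u v).
  exact: coord_continuous.
- apply: (@continuous_comp _ _ _ _ (fun M : 'rV[R]_n.+1 => M 0 k)).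
    exact: (DDf_cont v u).
  exact: coord_continuous.
Qed.

(** * Forms and their exterior derivatives along a parametrized surface *)

Lemma pairingE (R : realType) (w : 'cV[R]_4) (v : 'rV[R]_4) :
  pairing w v = \sum_k v 0 k * w k 0.
Proof. by rewrite /pairing mxE. Qed.

(** Leibniz rule, from the product rule in each of the four coordinates. *)
Lemma is_derive_pairing (R : realType) (E : normedModType R)
    (F : E -> 'cV[R]_4) (G : E -> 'rV[R]_4) (s v : E) :
  derivable F s v -> derivable G s v ->
  is_derive s v (fun t => pairing (F t) (G t) : R^o)
    (pairing ('D_v F s) (G s) + pairing (F s) ('D_v G s)).
Proof.
move=> dF dG.
have -> : (fun t => pairing (F t) (G t) : R^o) =
    \sum_(k < 4) ((fun t => G t 0 k) * (fun t => F t k 0)).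
  by apply/funext => t; rewrite fct_sumE pairingE.
have dFk k : derivable (fun t => F t k 0) s v by apply: (derivable_mxP F s v).1.
have dGk k : derivable (fun t => G t 0 k) s v by apply: (derivable_mxP G s v).1.
apply: is_derive_eq.
  by apply: is_derive_sum => k; apply: is_deriveM; apply: derivableP.
rewrite !pairingE -big_split /=; apply: eq_bigr => k _.
have -> : 'D_v F s k 0 = 'D_v (fun t => F t k 0) s by rewrite (derive_mx dF) mxE.
have -> : 'D_v G s 0 k = 'D_v (fun t => G t 0 k) s by rewrite (derive_mx dG) mxE.
by congr (_ + _); rewrite [LHS]mulrC.
Qed.

(* Pulling s back along f: both sides of d(f^*s) = f^*(ds) vanish. *)
Lemma dform_integral_surface (R : realType) (D : set 'rV[R]_2)
    (f : 'rV[R]_2 -> 'rV[R]_4) (s : form1 R) (t u v : 'rV[R]_2) :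
  open D -> smooth_on D f -> D t -> differentiable s (f t) ->
  (forall y z, D y -> pairing (s (f y)) ('D_z f y) = 0) ->
  dform s (f t) ('D_u f t) ('D_v f t) = 0.
Proof.
move=> oD sf Dt ds sf0.
have df : differentiable f t by have [+ _] := sf 1%N; apply.
have dDf z : differentiable (fun y => 'D_z f y) t.
  by have [_ /(_ z) [+ _]] := sf 2%N; apply.
(* Differentiating the identity [sf0] along [z] trades the derivative of the form for a second
   derivative of [f]. *)
have Dform z z' : 'D_('D_z f t) (fun y => pairing (s y) ('D_z' f t) : R^o) (f t)
    = - pairing (s (f t)) ('D_z (fun y => 'D_z' f y) t).
  have [_ ->] := is_derive_pairing _ _ _ _ (f t) ('D_z f t)
    (diff_derivable ds) (derivable_cst ('D_z' f t) (f t) ('D_z f t)).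
  have dsf : differentiable (s \o f) t by exact: differentiable_comp.
  have [_] := is_derive_pairing _ _ _ _ t z
    (diff_derivable dsf) (diff_derivable (dDf z')).
  have -> : 'D_z (s \o f) t = 'D_('D_z f t) s (f t).
    by rewrite !deriveE// diff_comp.
  have -> : 'D_z (fun y => pairing ((s \o f) y) ('D_z' f y) : R^o) t = 0.
    (* The pairing vanishes on the open set [D], hence is locally constant at [t]. *)
    rewrite (@near_eq_derive R _ R^o _ (cst 0)) ?derive_cst//.
    by apply: filterS (open_nbhs_nbhs (conj oD Dt)) => y Dy; exact: sf0.
  move=> /esym/eqP; rewrite addr_eq0 => /eqP ->.
  by rewrite derive_cst [pairing _ 0]/pairing mul0mx [X in _ + X]mxE addr0.
(* Only two mixed second derivatives of [f] remain, and they cancel by symmetry. *)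
rewrite /dform (Dform u v) (Dform v u).
by rewrite (schwarz_smooth _ _ _ D f t v u oD sf Dt) subrr.
Qed.

(** * The web in frames with $a_2=0$ *)

Lemma ord2P (i : 'I_2) : i = 0 \/ i = 1.
Proof. by case: i => -[|[|//]] ?; [left|right]; apply: val_inj. Qed.

Section SpecializedWeb.
Context {R : realType}.
Notation V := 'rV[R]_4.
Implicit Types (om : 'I_3 -> 'I_2 -> form1 R) (w : 'I_2 -> 'I_2 -> form1 R)
  (a : 'I_2 -> V -> R) (e : 'I_2 * 'I_2 -> vfield R).

Lemma coframe0E om i : coframe om (0, i) = om 0 i.
Proof. by rewrite /coframe; congr om; apply: val_inj. Qed.

Lemma coframe1E om i : coframe om (1, i) = om 1 i.
Proof. by rewrite /coframe; congr om; apply: val_inj. Qed.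

Lemma a_distributionE om a x : a 0 x != 0 -> a 1 x = 0 ->
  a_distribution om a x =
  [set v | forall alpha, pairing (coframe om (alpha, 0) x) v = 0].
Proof.
move=> a0 a1; have sumE alpha v :
    \sum_i a i x * pairing (coframe om (alpha, i) x) v
    = a 0 x * pairing (coframe om (alpha, 0) x) v.
  rewrite big_ord_recl big_ord1 (_ : lift ord0 ord0 = 1) ?a1 ?mul0r ?addr0//.
  exact: val_inj.
apply/seteqP; split=> v /= vL alpha; last by rewrite sumE vL mulr0.
by apply/eqP; move: (vL alpha); rewrite sumE => /eqP; rewrite mulf_eq0 (negbTE a0).
Qed.

(** Both halves of $a_{[2}\delta^1_{k]}$ vanish, by $a_2=0$ and $\delta^1_2=0$. *)
Lemma theta_specialized om w a (p q : R) x : a 1 x = 0 ->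
  theta om w a p q 0 1 x = w 0 1 x.
Proof.
move=> a1; rewrite /theta big1 ?addr0// => k _.
by rewrite /torsion a1 mul0r mulr0 subrr mul0r scale0r.
Qed.

Lemma pairing_dual_frame (U : set V) om e (x : V) (Q : 'I_2 * 'I_2)
    (c : 'I_2 * 'I_2 -> R) :
  dual_frame U om e -> U x ->
  pairing (coframe om Q x) (\sum_P c P *: e P x) = c Q.
Proof.
move=> he Ux; have entry P : (e P x *m coframe om Q x) 0 0 = (Q == P)%:R.
  exact: he.
rewrite /pairing mulmx_suml summxE (bigD1 Q)//= big1.
  by rewrite -scalemxAl mxE entry eqxx mulr1 addr0.
by move=> P PQ; rewrite -scalemxAl mxE entry eq_sym (negbTE PQ) mulr0.
Qed.

Lemma pairing_covariant_derivative (U : set V) om e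
    (Theta : 'I_2 * 'I_2 -> 'I_2 * 'I_2 -> form1 R) (E : normedModType R)
    (g Y : E -> V) (s v : E) (Q : 'I_2 * 'I_2) :
  dual_frame U om e -> U (g s) ->
  pairing (coframe om Q (g s)) (covariant_derivative om e Theta g Y s v) =
  'D_v (fun t => pairing (coframe om Q (g t)) (Y t) : R^o) s
  + \sum_P pairing (Theta Q P (g s)) ('D_v g s)
           * pairing (coframe om P (g s)) (Y s).
Proof.
by move=> he Ugs; rewrite /covariant_derivative (pairing_dual_frame _ _ _ _ Q _ he Ugs).
Qed.

(** Common core of (i) and (ii): [g] is a parametrization in the first case and the identity in the
    second. It remains to show that the components of the derivative along $e_1^1$, $e_1^2$
    vanish. *)
Lemma covariant_derivative_a_distribution (U : set V) om w a e
    (p q : R) (E : normedModType R) (D : set E) (g Y : E -> V) (s v : E) :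
  dual_frame U om e ->
  (forall x, U x -> a 0 x != 0) -> (forall x, U x -> a 1 x = 0) ->
  open D -> D s -> (forall t, D t -> U (g t)) ->
  (forall t, D t -> a_distribution om a (g t) (Y t)) ->
  pairing (w 0 1 (g s)) ('D_v g s) = 0 ->
  a_distribution om a (g s) (covariant_derivative om e
    (block_connection (theta om w a p q)) g Y s v).
Proof.
move=> he a0 a1 oD Ds gU YL w0.
have Y0 t alpha : D t -> pairing (coframe om (alpha, 0) (g t)) (Y t) = 0.
  move=> Dt; have Ut := gU _ Dt.
  by have := YL t Dt; rewrite a_distributionE ?a0 ?a1//; apply.
have Us := gU _ Ds.
rewrite a_distributionE ?a0 ?a1// => alpha /=.
rewrite (pairing_covariant_derivative U)//.
rewrite (@near_eq_derive R _ R^o _ (cst 0)) ?derive_cst ?add0r; last first.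
  by apply: filterS (open_nbhs_nbhs (conj oD Ds)) => t Dt; exact: Y0.
(* Off-diagonal blocks are zero; in the diagonal one, [Y] has no component with [j] = 0, and for [j]
   = 1 the coefficient is $\omega_2^1$. *)
apply: big1 => -[beta j] _; rewrite /block_connection /=.
have [_|_] := eqVneq alpha beta; last by rewrite {1}/pairing mulmx0 mxE mul0r.
have [->|->] := ord2P j.
- by rewrite Y0 ?mulr0.
- by rewrite theta_specialized ?a1// w0 mul0r.
Qed.

(** Every other term of the structure equation, including all those in $a_j$, has a factor
    $\omega_{(\alpha)}^1$, which is zero on [u] and [v]. *)
Lemma structure_on_kernel (U : set V) om w a b pa qa alpha (x u v : V) :
  structure_equations U om w a b pa qa -> U x ->
  pairing (coframe om (alpha, 0) x) u = 0 ->
  pairing (coframe om (alpha, 0) x) v = 0 ->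
  dform (coframe om (alpha, 0)) x u v = wedge (coframe om (alpha, 1)) (w 0 1) x u v.
Proof.
move=> hstr Ux.
have lift1 : lift ord0 ord0 = 1 :> 'I_2 by apply: val_inj.
have [->|->] := ord2P alpha.
- rewrite !coframe0E => u0 v0; rewrite (structure1 hstr)//.
  by rewrite !big_ord_recl !big_ord0 lift1 /wedge u0 v0; ring.
- rewrite !coframe1E => u0 v0; rewrite (structure2 hstr)//.
  by rewrite !big_ord_recl !big_ord0 lift1 /wedge u0 v0; ring.
Qed.

(** On the surface $\omega_2^1$ has zero wedge product with both $\omega_{(1)}^2$ and
    $\omega_{(2)}^2$, which are independent there, so it vanishes. *)
Lemma connection_integral_surface (U : set V) om w a b pa qa e
    (D : set 'rV[R]_2) (f : 'rV[R]_2 -> V) (s v : 'rV[R]_2) :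
  (forall u i, smooth_on U (om u i)) -> dual_frame U om e ->
  structure_equations U om w a b pa qa ->
  (forall x, U x -> a 0 x != 0) -> (forall x, U x -> a 1 x = 0) ->
  integral_surface U (a_distribution om a) D f -> D s ->
  pairing (w 0 1 (f s)) ('D_v f s) = 0.
Proof.
move=> som he hstr a0 a1 [oD sf fU tf] Ds.
have Us := fU s Ds.
have kernel alpha t z : D t -> pairing (coframe om (alpha, 0) (f t)) ('D_z f t) = 0.
  move=> Dt; have Ut := fU t Dt.
  have : tangent_plane f t ('D_z f t) by exists z.
  by rewrite tf// a_distributionE ?a0 ?a1 //; apply.
have closed alpha y z :
    wedge (coframe om (alpha, 1)) (w 0 1) (f s) ('D_y f s) ('D_z f s) = 0.
  rewrite -(structure_on_kernel _ _ _ _ _ _ _ _ _ _ _ hstr Us);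
    [|exact: kernel..].
  apply: (dform_integral_surface _ _ _ _ _ _ _ oD sf Ds) => [|t z' Dt].
    by have [+ _] := som (widen_ord (leqnSn 2) alpha) 0 1%N; apply.
  exact: kernel.
(* The tangent plane is all of $\Delta$, so $e_2^1$ and $e_2^2$ are themselves derivatives of
   [f]. *)
have frame alpha : exists z, 'D_z f s = e (alpha, 1) (f s).
  have : tangent_plane f s (e (alpha, 1) (f s)).
    rewrite tf// a_distributionE ?a0 ?a1 //= => beta.
    by rewrite (he _ _ _ Us) xpair_eqE andbF.
  by case=> z _ <-; exists z.
have [y0 Ey0] := frame 0; have [y1 Ey1] := frame 1.
(* The relation for $\omega_{(2)}^2$, evaluated on $e_2^2$, $e_2^1$. *)
have w_e0 : pairing (w 0 1 (f s)) (e (0, 1) (f s)) = 0.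
  have := closed 1 y1 y0; rewrite /wedge Ey0 Ey1 !(he _ _ _ Us).
  by rewrite mul1r mul0r subr0.
(* The relation for $\omega_{(1)}^2$ on the direction [v] and $e_2^1$ leaves only $-\omega_2^1$ on
   the tangent vector, by [w_e0]. *)
have := closed 0 v y0; rewrite /wedge Ey0 w_e0 (he _ _ _ Us) eqxx mulr0 mul1r.
by move=> /eqP; rewrite sub0r oppr_eq0 => /eqP.
Qed.

End SpecializedWeb.

(** * Totally geodesic and geodesicly parallel integral surfaces *)

Theorem theorem4 (R : realType) (U : set 'rV[R]_4)
    (lam : 'I_3 -> plane_field R)
    (om : 'I_3 -> 'I_2 -> form1 R) (e : 'I_2 * 'I_2 -> vfield R)
    (w : 'I_2 -> 'I_2 -> form1 R) (a : 'I_2 -> 'rV[R]_4 -> R)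
    (b : 'I_2 -> 'I_2 -> 'I_2 -> 'I_2 -> 'rV[R]_4 -> R)
    (pa qa : 'I_2 -> 'I_2 -> 'rV[R]_4 -> R)
    (hweb : web322 U lam)
    (hom : adapted_coframe U lam om)
    (he : dual_frame U om e)
    (hstr : structure_equations U om w a b pa qa)
    (ha : forall x, U x -> exists i, a i x != 0)
    (ha2 : forall x, U x -> a 1 x = 0) :
  (integrable_plane_field U (a_distribution om a) ->
     forall (p q : R) (D : set 'rV[R]_2) (f : 'rV[R]_2 -> 'rV[R]_4),
       integral_surface U (a_distribution om a) D f ->
       totally_geodesic om e (block_connection (theta om w a p q)) D f)
  /\
  ((forall x, U x -> w 0 1 x = 0) ->
     forall p q : R,
       geodesicly_parallel U om e (block_connection (theta om w a p q))
         (a_distribution om a)).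
Proof.
(* With $a_2=0$, a nonzero covector must have $a_1\neq 0$. *)
have a0 x : U x -> a 0 x != 0.
  move=> Ux; have [i] := ha x Ux; have [-> //|->] := ord2P i.
  by rewrite ha2// eqxx.
split=> [_ p q D f surf Y _ Yt s v Ds|w0 p q Y _ YL x X Ux].
- have [oD _ fU tf] := surf.
  rewrite tf//; apply: (covariant_derivative_a_distribution U om w a e p q _ D) => //.
    by move=> t Dt; rewrite -tf//; exact: Yt.
  exact: (connection_integral_surface U om w a b pa qa e D f s v (adapted_smooth hom)).
- have oU := web_open hweb.
  apply: (covariant_derivative_a_distribution U om w a e p q _ U) => //.
  by rewrite w0// /pairing mulmx0 mxE.
Qed.
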